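(* The following hold (in $\mathrm{ZFC}$), with the relational systems $\mathbf R_b$ defined in the context: (1) For every dominating family $D\subseteq\omega^\omega$ (all of whose members $b$ satisfy $b(n)>0$ for all $n$), $\sup_{b\in D}\mathfrak d(\mathbf R_b)\le \mathrm{cov}(\mathcal{MA})\le \mathfrak d\left(\prod_{b\in D}\mathbf R_b\right)$. (2) For all $b\in\omega^\omega$ (with $b(n)>0$ for all $n$), $\mathfrak d(\mathbf R_b)\le\mathrm{cof}(\mathcal M)$. (3) Let $b\in\omega^\omega$ (with $b(n)>0$ for all $n$). If $\sum_{k<\omega}\frac1{b(k)}<\infty$, then $\mathfrak b(\mathbf R_b)\le\mathrm{non}(\mathcal E)$ and $\mathrm{cov}(\mathcal E)\le\mathfrak d(\mathbf R_b)$.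
   Context: Ideals: $2^\omega$ is a topological group with coordinatewise addition modulo $2$. $\mathcal M$ is the ideal of meager subsets of $2^\omega$, and $\mathcal E$ is the $\sigma$-ideal generated by the closed measure zero subsets of $2^\omega$. $X\subseteq2^\omega$ is meager-additive if $A+X\in\mathcal M$ for every $A\in\mathcal M$; $\mathcal{MA}$ is the ideal of meager-additive sets. For an ideal $\mathcal I$ on $2^\omega$ containing all singletons: $\mathrm{cov}(\mathcal I)=\min\{|\mathcal J| : \mathcal J\subseteq\mathcal I,\ \bigcup\mathcal J=2^\omega\}$, $\mathrm{non}(\mathcal I)=\min\{|A| : A\subseteq2^\omega,\ A\notin\mathcal I\}$, $\mathrm{cof}(\mathcal I)=\min\{|\mathcal J| : \mathcal J\subseteq\mathcal I,\ \forall A\in\mathcal I\,\exists B\in\mathcal J\colon A\subseteq B\}$. A family $D\subseteq\omega^\omega$ is dominating if for every $x\in\omega^\omega$ there is $y\in D$ with $x\le^* y$, i.e. $x(n)\le y(n)$ for all but finitely many $n$. Relational systems: a relational system is a triple $\mathbf R=\langle X,Y,\sqsubset\rangle$ with $X,Y$ non-empty sets and $\sqsubset$ a relation. $\mathfrak b(\mathbf R)=\min\{|F| : F\subseteq X,\ \neg\exists y\in Y\,\forall x\in F\colon x\sqsubset y\}$ and $\mathfrak d(\mathbf R)=\min\{|D| : D\subseteq Y,\ \forall x\in X\,\exists y\in D\colon x\sqsubset y\}$. The product of $\mathbf R_i=\langle X_i,Y_i,\sqsubset_i\rangle$ ($i\in K$) is $\prod_{i\in K}\mathbf R_i=\langle\prod_iX_i,\prod_iY_i,\sqsubset^\times\rangle$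 where $x\sqsubset^\times y$ iff $x_i\sqsubset_iy_i$ for all $i\in K$. $\mathbb I$ denotes the set of partitions $I=\langle I_n : n<\omega\rangle$ of $\omega$ into finite non-empty intervals (enumerated increasingly). For $b\in\omega^\omega$ with $b(n)>0$ for all $n$, $\prod b=\prod_{n<\omega}b(n)$ (each $b(n)$ being the set $\{0,\dots,b(n)-1\}$), and $\mathbf R_b=\langle\prod b,\ \mathbb I\times\prod b,\ \sqsubset^\bullet\rangle$ where $f\sqsubset^\bullet(I,h)$ iff for all but finitely many $n$ there is $k\in I_n$ with $f(k)=h(k)$. *)

(* Defs.v *)
From HB Require Import structures.
From mathcomp Require Import all_boot all_order all_algebra.
From mathcomp Require Import all_classical all_reals all_analysis.

Set Implicit Arguments.
Unset Strict Implicit.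
Unset Printing Implicit Defensive.

Import Order.TTheory GRing.Theory Num.Theory.

Local Open Scope classical_set_scope.
Local Open Scope card_scope.

(* A cardinal is represented by a set having that cardinality;
    cardinals are compared with [#<=] and [#=] of mathcomp.classical.cardinality. *)

(* min {|A| : A in K}, represented by a member of K of least cardinality.  Since
   cardinals are well-ordered, such a member exists as soon as K is nonempty;
   [set0] is a junk value for empty K. *)
Definition min_card (T : Type) (K : set (set T)) : set T :=
  xget set0 [set A | K A /\ forall B, K B -> A #<= B].

(* The supremum of the cardinals |A i|, as the least upper bound among the
   cardinalities of subsets of the disjoint union of the T i.  The disjoint union
   itself is an upper bound, so restricting to its subsets loses nothing. *)
Definition sup_card (K : Type) (T : K -> Type) (A : forall i, set (T i)) :
    set {i : K & T i} :=
  min_card [set B : set {i : K & T i} | forall i, A i #<= B].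

Record relsys := RelSys {
  rdom : Type;
  rcod : Type;
  rrel : rdom -> rcod -> Prop;
  rdom_ne : $|rdom|;
  rcod_ne : $|rcod| }.

Definition frakb (S : relsys) : set (rdom S) :=
  min_card [set F : set (rdom S) |
    ~ exists y : rcod S, forall x, F x -> rrel x y].

Definition frakd (S : relsys) : set (rcod S) :=
  min_card [set D : set (rcod S) | forall x : rdom S, exists2 y, D y & rrel x y].

Arguments frakb : clear implicits.
Arguments frakd : clear implicits.

Lemma squash_forall (K : Type) (T : K -> Type) :
  (forall i, $|T i|) -> $|forall i, T i|.
Proof. by move=> ne; apply/squash => i; exact: unsquash (ne i). Qed.

Definition prod_relsys (K : Type) (S : K -> relsys) : relsys :=
  @RelSys (forall i, rdom (S i)) (forall i, rcod (S i))
    (fun x y => forall i, rrel (x i) (y i))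
    (squash_forall (fun i => rdom_ne (S i)))
    (squash_forall (fun i => rcod_ne (S i))).

Record interval_partition := IntervalPartition {
  block :> nat -> set nat;
  block_finite : forall n, finite_set (block n);
  block_nonempty : forall n, block n !=set0;
  block_interval : forall n i j k,
    block n i -> block n j -> (i <= k <= j)%N -> block n k;
  block_increasing : forall m n i j,
    (m < n)%N -> block m i -> block n j -> (i < j)%N;
  block_cover : \bigcup_n block n = [set: nat] }.

Lemma interval_partition_ne : $|interval_partition|.
Proof.
apply/squash; exists (fun n => [set n]).
- by move=> n; exact: finite_set1.
- by move=> n; exists n.
- move=> n i j k /= -> -> ?; apply/eqP; by rewrite eq_sym eqn_leq.
- by move=> m n i j ? -> ->.
- by apply/seteqP; split => // n _; exists n.
Qed.

Definition prodb (b : nat -> nat) : Type := forall n, 'I_(b n).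

Lemma prodb_ne (b : nat -> nat) : (forall n, (0 < b n)%N) -> $|prodb b|.
Proof. by move=> b0; apply/squash => n; exact: Ordinal (b0 n). Qed.

Lemma squash_pair (T U : Type) : $|T| -> $|U| -> $|(T * U)%type|.
Proof. by move=> t u; apply/squash; exact: (unsquash t, unsquash u). Qed.

Definition Rrel (b : nat -> nat) (f : prodb b)
    (Ih : interval_partition * prodb b) : Prop :=
  \forall n \near \oo, exists2 k, Ih.1 n k & f k = Ih.2 k.

Definition Rsys (b : nat -> nat) (b0 : forall n, (0 < b n)%N) : relsys :=
  @RelSys (prodb b) (interval_partition * prodb b)%type (@Rrel b)
    (prodb_ne b0) (squash_pair interval_partition_ne (prodb_ne b0)).

Arguments Rsys : clear implicits.

Definition dominating (D : set (nat -> nat)) : Prop :=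
  forall x : nat -> nat, exists2 y, D y & \forall n \near \oo, (x n <= y n)%N.

Definition covI (T : Type) (I : set (set T)) : set (set T) :=
  min_card [set J | J `<=` I /\ \bigcup_(A in J) A = [set: T]].

Definition nonI (T : Type) (I : set (set T)) : set T :=
  min_card [set A | ~ I A].

Definition cofI (T : Type) (I : set (set T)) : set (set T) :=
  min_card [set J | J `<=` I /\ forall A, I A -> exists2 B, J B & A `<=` B].

Definition sigma_ideal (T : Type) : set (set (set T)) :=
  [set I | [/\ I set0,
               forall A B, A `<=` B -> I B -> I A &
               forall F : nat -> set T,
                 (forall n, I (F n)) -> I (\bigcup_n F n)]].

Definition nowhere_dense (T : topologicalType) (A : set T) : Prop :=
  interior (closure A) = set0.

Definition meager (T : topologicalType) : set (set T) :=
  [set A | exists2 F : nat -> set T,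
             forall n, nowhere_dense (F n) & A = \bigcup_n F n].

Definition cantor_add (x y : cantor_space) : cantor_space :=
  fun n => addb (x n) (y n).

Definition meager_additive : set (set cantor_space) :=
  [set X | forall A : set cantor_space,
     meager A -> meager [set cantor_add a x | a in A & x in X]].

Definition cylinder (s : seq bool) : set cantor_space :=
  [set x | forall i, (i < size s)%N -> x i = nth false s i].

(* The outer measure induced by the product of the uniform measures on {0,1}
   (the Haar probability measure of the Cantor group); it coincides with that
   measure on closed sets. *)
Definition cantor_outer_measure (R : realType) (A : set cantor_space) : \bar R :=
  ereal_inf [set (\sum_(0 <= i <oo) ((2 ^+ size (s i))^-1 : R)%:E)%E |
              s in [set s : nat -> seq bool | A `<=` \bigcup_i cylinder (s i)]].

Definition ideal_E (R : realType) : set (set cantor_space) :=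
  smallest (@sigma_ideal cantor_space)
    [set F | closed F /\ cantor_outer_measure R F = 0%E].

(* Main.v *)
Require Import Defs.
From HB Require Import structures.
From mathcomp Require Import all_boot all_order all_algebra.
From mathcomp Require Import all_classical all_reals all_analysis.

(** All three parts are Tukey-style reductions: to compare two invariants it
suffices to map challenges one way and responses the other way.  Two codings
link the Cantor space to a product of finite sets [prodb b].

Unary coding (lower bound in (1), and (2)).  Cut the natural numbers into
consecutive intervals with [b k] points in the k-th one, and let
[unary_code f] mark the [f k]-th point of each.  Let [hitting_set b] be the
meager set of those z that have a 1 in each interval.  A meager set B is
contained, for some point y and some coarser interval partition, in the set of
the z that differ from y on almost all intervals ([meager_mismatch]).  If B
contains the translate of [hitting_set b] by [unary_code f], then y must agree
with [unary_code f] on a fine interval inside almost every coarse one: where it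
does not, one can follow y and still differ from [unary_code f] on every fine
interval, producing a point of the translate that meets y infinitely often.
Reading off y on the fine intervals gives a response to f that depends on B
only ([meager_bounds_translates]).  For (2), B ranges over a cofinal family of
meager sets; for (1), over the sums of [hitting_set b] with the members of a
cover of the space by meager-additive sets.

Prefix coding (upper bound in (1), and (3)).  Let [prefix_code x k] be a number
below [b k] coding the initial segment of x of length log2 (b k).  If b grows
fast compared with a partition into intervals, then guessing [prefix_code x k]
amounts to guessing x on the k-th interval.  So a set of points whose prefix
codes are bounded for every b in a dominating family is, for every interval
partition, guessed by one point on some interval within almost every block of
a coarser partition; that property implies meager-additivity
([meager_additive_of_block_guess]).  If the reciprocals of b are summable, then
[prefix_code x k = h k] defines a set of measure at most 2 / b k, so the set of
the x whose code is captured by (J, h) is a countable union of closed null sets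
([prefix_code_bounded_E]).

Since minimal cardinals over an empty family have a junk value, one also needs
that the family defining the right-hand side of each inequality is nonempty.
This is trivial except for non(E), where the whole space must not belong to E:
closed null sets are nowhere dense, hence E consists of meager sets. *)

Set Implicit Arguments.
Unset Strict Implicit.
Unset Printing Implicit Defensive.

Import Order.TTheory GRing.Theory Num.Theory.

Local Open Scope classical_set_scope.
Local Open Scope card_scope.

(** * Least cardinals *)

Lemma card_le_inj (T U : Type) (A : set T) (B : set U) (f : T -> U) :
  (forall x, A x -> B (f x)) ->
  (forall x y, A x -> A y -> f x = f y -> x = y) -> A #<= B.
Proof.
move=> fAB finj.
have injf : {in A &, injective f}.
  by move=> x y /set_mem Ax /set_mem Ay; exact: finj.
apply: (@card_le_trans _ _ _ (f @` A)).
  by have := inj_card_eq injf; rewrite card_eq_le => /andP[].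
by apply: subset_card_le => _ [x Ax <-]; exact: fAB.
Qed.

Lemma card_le_surj (T U : Type) (A : set T) (B : set U) (g : U -> T) :
  A `<=` g @` B -> A #<= B.
Proof. by move/subset_card_le/card_le_trans; apply; exact: card_image_le. Qed.

(** Cardinals are well-ordered.  Take a maximal set G of choice functions that
take pairwise distinct values at every index.  By maximality the values of G
exhaust some [A i], and then G is a copy of [A i] that injects into each
[A j]. *)
Lemma card_le_least (I : Type) (T : I -> Type) (A : forall i, set (T i)) :
  inhabited I -> exists i, forall j, A i #<= A j.
Proof.
move=> [i0].
have [[i Ai0]|nA0] := pselect (exists i, A i = set0).
  by exists i => j; rewrite Ai0; exact: card_ge0.
pose P := [set G : set (forall i, T i) |
  (forall g i, G g -> A i (g i)) /\
  (forall i g h, G g -> G h -> g i = h i -> g = h)].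
have [F FP Ftot|G [[GA Ginj] Gmax]] := @Zorn_bigcup _ P.
  split=> [g i [G FG]|i g h [G FG Gg] [H FH Hh]]; first exact: (FP _ FG).1.
  have [GH|HG] := Ftot _ _ FG FH; first by apply: (FP _ FH).2 => //; exact: GH.
  by apply: (FP _ FG).2 => //; exact: HG.
have [[i AG]|noA] := pselect (exists i, A i `<=` (fun g => g i) @` G).
  exists i => j; apply: (@card_le_trans _ _ _ G); first exact: card_le_surj AG.
  apply: (@card_le_inj _ _ _ _ (fun g => g j)) => [g|g h]; first exact: GA.
  exact: Ginj.
have fresh i : {a | A i a /\ forall g, G g -> g i <> a}.
  apply: cid; apply: contrapT => nofresh; apply: noA; exists i => a Aa.
  apply: contrapT => nGa; apply: nofresh; exists a; split=> // g Gg gia.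
  by apply: nGa; exists g.
pose g0 i := sval (fresh i).
have g0_new i g : G g -> g i <> g0 i by move=> Gg; exact: (svalP (fresh i)).2.
exfalso; apply: (Gmax (G `|` [set g0])).
  split=> [g Gg|sub]; first by left.
  by apply: (g0_new i0 g0) => //; apply: sub; right.
split=> [g i [/GA//|->]|i g h [Gg|->] [Gh|->] // gi].
- exact: (svalP (fresh i)).1.
- exact: Ginj gi.
- by case: (g0_new i g).
- by case: (g0_new i h).
Qed.

Lemma card_le_comparable (T U : Type) (A : set T) (B : set U) :
  A #<= B \/ B #<= A.
Proof.
pose V c : Type := if c then T else U.
pose S c : set (V c) := if c is true then A else B.
have [[] least] := card_le_least S (inhabits true).
  by left; exact: least false.
by right; exact: least true.
Qed.

Lemma min_cardP (T : Type) (K : set (set T)) : K !=set0 ->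
  K (min_card K) /\ forall B, K B -> min_card K #<= B.
Proof.
move=> [A0 KA0].
apply: (@xgetPex _ set0 [set A | K A /\ forall B, K B -> A #<= B]).
have [|[A KA] least] := @card_le_least {A | K A} _ (fun A => sval A).
  by split; exists A0.
by exists A; split=> // B KB; exact: least (exist _ B KB).
Qed.

Lemma min_card_le (T U : Type) (K : set (set T)) (A : set U) :
  (exists2 B, K B & B #<= A) -> min_card K #<= A.
Proof.
move=> [B KB]; apply: card_le_trans.
by have [|_] := @min_cardP _ K; [exists B | exact].
Qed.

(** An upper bound C of larger cardinality than the disjoint union can be
replaced by the disjoint union itself, so every upper bound is represented. *)
Lemma sup_card_le (K : Type) (T : K -> Type) (A : forall i, set (T i))
    (U : Type) (C : set U) :
  (forall i, A i #<= C) -> sup_card A #<= C.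
Proof.
move=> AC; apply: min_card_le.
have [CT|TC] := card_le_comparable C [set: {i : K & T i}].
  move: CT => /card_subP[B] /= + _; rewrite card_eq_le => /andP[BC CB].
  by exists B => //= i; exact: card_le_trans (AC i) CB.
exists setT => //= i; apply: (@card_le_inj _ _ _ _ (existT T i)) => // x y _ _.
exact: (@existT_inj2 {classic K} T).
Qed.

(** * Nowhere dense and meager sets of the Cantor space *)

Definition agree (n : nat) (x : cantor_space) : set cantor_space :=
  [set z | forall i, (i < n)%N -> z i = x i].

Lemma agree_widen m n x : (m <= n)%N -> agree n x `<=` agree m x.
Proof. by move=> mn z xz i im; apply: xz; exact: leq_trans mn. Qed.

Lemma agree_trans n x y z : agree n x y -> agree n y z -> agree n x z.
Proof. by move=> xy yz i ilt; rewrite yz// xy. Qed.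

(** The sets [agree n x] generate a filter that converges to x in every
coordinate, hence in the product topology. *)
Lemma nbhs_agree (x : cantor_space) (U : set cantor_space) :
  nbhs x U <-> exists n, agree n x `<=` U.
Proof.
split=> [xU|[n]].
  pose F := filter_from [set: nat] (fun n => agree n x).
  have FF : Filter F.
    apply: filter_from_filter; first by exists 0%N.
    move=> m n _ _; exists (maxn m n) => // z xz.
    by split; apply: agree_widen xz; rewrite ?leq_maxl ?leq_maxr.
  suff : F --> x by move=> /(_ _ xU)[n _ nU]; exists n.
  apply/cvg_sup => i A [B [[C oC <-] Cx] BA].
  exists i.+1 => // z /(_ i (ltnSn _)) zi; apply: BA => /=.
  by move: Cx => /=; rewrite zi.
move=> nU; apply: filterS nU _; elim: n => [|n IH].
  by apply: filterS filterT.
have nx : nbhs x [set z : cantor_space | z n = x n].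
  apply: (@proj_continuous _ (fun _ : nat => bool) n x [set x n]).
  exact: (@discrete_open bool).
apply: filterS2 IH nx => z zx znx i.
by rewrite ltnS leq_eqVlt => /predU1P[->//|/zx].
Qed.

Lemma nowhere_denseP (F : set cantor_space) :
  nowhere_dense F <->
  forall x n, exists y m,
    [/\ (n <= m)%N, agree n x y & forall z, agree m y z -> ~ F z].
Proof.
split=> [nF x n|nF].
  have : ~ agree n x `<=` closure F.
    move=> subF; suff : interior (closure F) x by rewrite nF.
    by apply/nbhs_agree; exists n.
  move=> /existsNP[y /not_implyP[xy /existsNP[U /not_implyP[]]]].
  move=> /nbhs_agree[m mU] FU; exists y, (maxn n m); split=> //.
    exact: leq_maxl.
  move=> z yz Fz; apply: FU; exists z; split=> //; apply: mU.
  exact: agree_widen (leq_maxr _ _) _ yz.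
rewrite /nowhere_dense -subset0 => x /nbhs_agree[n xF].
have [y [m [_ /xF Fy yF]]] := nF x n.
have [|z [Fz yz]] := Fy (agree m y); last exact: yF yz Fz.
by apply/nbhs_agree; exists m.
Qed.

Lemma nowhere_denseU (F G : set cantor_space) :
  nowhere_dense F -> nowhere_dense G -> nowhere_dense (F `|` G).
Proof.
move=> /nowhere_denseP nF /nowhere_denseP nG; apply/nowhere_denseP => x n.
have [y [m [nm xy yF]]] := nF x n; have [z [k [mk yz zG]]] := nG y m.
exists z, k; split=> [||w zw [|]].
- exact: leq_trans mk.
- exact: agree_trans xy (agree_widen nm yz).
- by apply: yF; exact: agree_trans yz (agree_widen mk zw).
- exact: zG.
Qed.

Lemma nowhere_denseS (F G : set cantor_space) :
  F `<=` G -> nowhere_dense G -> nowhere_dense F.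
Proof.
move=> FG /nowhere_denseP nG; apply/nowhere_denseP => x n.
have [y [m [nm xy yG]]] := nG x n.
by exists y, m; split=> // z /yG nGz /FG.
Qed.

Lemma nowhere_dense0 : nowhere_dense (set0 : set cantor_space).
Proof. by apply/nowhere_denseP => x n; exists x, n; split=> // z _ []. Qed.

Lemma meagerS (A B : set cantor_space) : A `<=` B -> meager B -> meager A.
Proof.
move=> AB [F nF BF]; exists (fun n => A `&` F n).
  by move=> n; exact: nowhere_denseS (@subIsetr _ _ _) (nF n).
by rewrite -setI_bigcupr -BF; apply/esym/setIidPl.
Qed.

Lemma nowhere_dense_meager (F : set cantor_space) : nowhere_dense F -> meager F.
Proof.
by move=> nF; exists (fun=> F) => //; rewrite bigcup_const //; exists 0%N.
Qed.

Lemma meager_bigcup (F : nat -> set cantor_space) :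
  (forall n, meager (F n)) -> meager (\bigcup_n F n).
Proof.
move=> mF; have mF' n : exists G : nat -> set cantor_space,
    (forall m, nowhere_dense (G m)) /\ F n = \bigcup_m G m.
  by have [G nG FG] := mF n; exists G.
have /choice[G Gp] := mF'.
exists (fun k => if unpickle k is Some (m, n) then G m n else set0).
  by move=> k; case: unpickle => [[m n]|]; [exact: (Gp m).1 | exact: nowhere_dense0].
apply/seteqP; split=> [z [m _]|z [k _]].
  rewrite (Gp m).2 => -[n _ Gz]; exists (pickle (m, n)) => //.
  by rewrite pickleK.
by case: unpickle => [[m n] Gz|//]; exists m => //; rewrite (Gp m).2; exists n.
Qed.

Lemma meager_sigma_ideal : sigma_ideal (@meager cantor_space).
Proof.
split; [exact: nowhere_dense_meager nowhere_dense0|exact: meagerS|].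
exact: meager_bigcup.
Qed.

(** * Partitions into intervals given by their endpoints *)

Section StrictlyIncreasing.
Variable g : nat -> nat.
Hypothesis g_incr : forall n, (g n < g n.+1)%N.

Lemma incr_leq m n : (m <= n)%N -> (g m <= g n)%N.
Proof.
by apply: (@homo_leq _ g leq leqnn leq_trans) => k; exact: ltnW.
Qed.

Lemma incr_ge n : (n <= g n)%N.
Proof. by elim: n => // n /leq_ltn_trans; apply. Qed.

Lemma incr_block_lt k l i j :
  (k < l)%N -> (i < g k.+1)%N -> (g l <= j)%N -> (i < j)%N.
Proof. by move=> /incr_leq kl ik /(leq_trans kl); exact: leq_trans. Qed.

Lemma incr_block_inj k l i : (g k <= i < g k.+1)%N -> (g l <= i < g l.+1)%N ->
  k = l.
Proof.
move=> /andP[ki ik] /andP[li il]; case: (ltngtP k l) => // kl.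
  by have := incr_block_lt kl ik li; rewrite ltnn.
by have := incr_block_lt kl il ki; rewrite ltnn.
Qed.

Lemma incr_glue (T : Type) (u : nat -> nat -> T) :
  exists v, forall k i, (g k <= i < g k.+1)%N -> v i = u k i.
Proof.
pose idx i := xget 0 [set k | (g k <= i < g k.+1)%N].
exists (fun i => u (idx i) i) => k i ki; suff -> : idx i = k by [].
apply: (incr_block_inj _ ki).
by apply: (@xgetPex _ 0 [set k | (g k <= i < g k.+1)%N]); exists k.
Qed.

Hypothesis g0 : g 0 = 0.

Lemma incr_block_ex i : exists k, (g k <= i < g k.+1)%N.
Proof.
have [|k gki kmax] := @ex_maxnP (fun k => g k <= i)%N i _ (fun k => leq_trans (incr_ge k)).
  by exists 0; rewrite g0.
by exists k; rewrite gki ltnNge; apply/negP => /kmax; rewrite ltnn.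
Qed.

Lemma incr_partition :
  exists J : interval_partition, forall n, J n = [set k | (g n <= k < g n.+1)%N].
Proof.
unshelve eexists (@IntervalPartition (fun n => [set k | (g n <= k < g n.+1)%N]) _ _ _ _ _) => //.
- move=> n; apply: (@sub_finite_set _ _ `I_(g n.+1)); last exact: finite_II.
  by move=> k /= /andP[].
- by move=> n; exists (g n); rewrite /= leqnn g_incr.
- move=> n i j k /= /andP[ni _] /andP[_ jn] /andP[ik kj].
  by rewrite (leq_trans ni ik) (leq_ltn_trans kj jn).
- by move=> m n i j mn /andP[_ im] /andP[nj _]; exact: incr_block_lt mn im nj.
- by apply/seteqP; split=> // i _; have [k] := incr_block_ex i; exists k.
Qed.

End StrictlyIncreasing.

(** * Meager sets are those mismatching a point on almost all intervals *)

(** One finite pattern above n avoids F whatever happens below n: treat the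
finitely many initial segments of length n one after the other, each time
extending the pattern found so far. *)
Lemma nowhere_dense_dodge (F : set cantor_space) n : nowhere_dense F ->
  exists ym : cantor_space * nat,
    forall z, (forall i, (n <= i < ym.2)%N -> z i = ym.1 i) -> ~ F z.
Proof.
move=> /nowhere_denseP nF.
suff [y [m [_ ymF]]] : exists y m, (n <= m)%N /\
    forall (t : n.-tuple bool) z, t \in enum {: n.-tuple bool} ->
      agree n (nth false t) z -> (forall i, (n <= i < m)%N -> z i = y i) -> ~ F z.
  exists (y, m) => z zy; apply: (ymF [tuple z i | i < n]) zy => [|i ilt].
    by rewrite mem_enum.
  by rewrite -(tnth_nth _ _ (Ordinal ilt)) tnth_mktuple.
elim: (enum _) => [|t s [y [m [nm ymF]]]]; first by exists point, n.
have [y' [m' [mm' yy' y'F]]] := nF (fun i => if (i < n)%N then nth false t i else y i) m.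
exists y', m'; split=> [|t' z]; first exact: leq_trans mm'.
rewrite inE => /predU1P[-> tz zy'|t's tz zy'].
  apply: y'F => i im'; have [ilt|nlei] := ltnP i n; last by rewrite zy' ?nlei.
  by rewrite tz// yy' ?ilt // (leq_trans ilt).
apply: ymF t's tz _ => i /andP[ni im].
by rewrite zy' ?ni ?(leq_trans im)// yy'// ltnNge ni.
Qed.

(** The pattern chosen on the n-th interval dodges the union of the first n
nowhere dense sets, so a point of the k-th set can match y only on intervals
of index below k.  The endpoints are taken among the values of [a], so that the
intervals are unions of intervals of the partition given by [a]. *)
Lemma meager_mismatch (a : nat -> nat) (B : set cantor_space) :
  (forall n, (a n < a n.+1)%N) -> meager B ->
  exists (c : nat -> nat) (y : cantor_space),
    [/\ c 0 = 0, forall n, (c n < c n.+1)%N &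
     forall z, B z ->
       \forall n \near \oo, ~ (forall i, (a (c n) <= i < a (c n.+1))%N -> z i = y i)].
Proof.
move=> a_incr [F nF ->].
pose G n := \big[setU/set0]_(i < n.+1) F i.
have nG n : nowhere_dense (G n).
  apply: (big_ind (@nowhere_dense cantor_space)) => //.
    exact: nowhere_dense0.
  by move=> P Q; exact: nowhere_denseU.
have /choice[Y YG] : forall kn : nat * nat, exists ym : cantor_space * nat,
    forall z, (forall i, (kn.2 <= i < ym.2)%N -> z i = ym.1 i) -> ~ G kn.1 z.
  by move=> [k n]; exact: nowhere_dense_dodge.
pose c := fix c k := if k is k'.+1
  then maxn (c k').+1 (Y (k', a (c k'))).2 else 0.
have c_incr k : (c k < c k.+1)%N by rewrite /= leq_maxl.
have ac_incr k : (a (c k) < a (c k.+1))%N.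
  exact: leq_trans (a_incr _) (incr_leq a_incr (c_incr k)).
have [y yY] := incr_glue ac_incr (fun k => (Y (k, a (c k))).1).
exists c, y; split=> // z [n _ Fz]; exists n => // k nk match_k.
apply: (YG (k, a (c k)) z).
  move=> i /andP[ki ik]; have kblock : (a (c k) <= i < a (c k.+1))%N.
    rewrite ki (leq_trans ik)//; apply: leq_trans (incr_ge a_incr _).
    exact: leq_maxr.
  by rewrite match_k// (yY k).
by rewrite /G -bigcup_mkord; exists n.
Qed.

(** Baire's theorem, as y does not differ from itself. *)
Lemma not_meagerT : ~ meager [set: cantor_space].
Proof.
move=> /(@meager_mismatch id _ (fun=> leqnn _))[c [y [_ _ /(_ y I)[n _ ny]]]].
exact: (ny n (leqnn _)).
Qed.

Lemma block_ge (J : interval_partition) n k : J n k -> (n <= k)%N.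
Proof.
elim: n k => // n IH k Jk; have [j Jj] := block_nonempty J n.
exact: leq_ltn_trans (IH _ Jj) (block_increasing (ltnSn n) Jj Jk).
Qed.

Lemma finite_set_ubound (S : set nat) : finite_set S ->
  exists m, forall i, S i -> (i < m)%N.
Proof.
move=> /finite_seqP[s ->]; exists (\max_(i <- s) i).+1 => i /= si.
by rewrite ltnS; exact: leq_bigmax_seq.
Qed.

(** Above a given initial segment one can still copy v on some [S n] with n large,
since [S n] lies above n. *)
Lemma nowhere_dense_mismatch (S : nat -> set nat) (v : cantor_space) m :
  (forall n, finite_set (S n)) -> (forall n i, S n i -> (n <= i)%N) ->
  nowhere_dense [set z : cantor_space | forall n, (m <= n)%N -> exists2 i, S n i & z i <> v i].
Proof.
move=> Sfin Sge; apply/nowhere_denseP => x n.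
have [p Sp] := finite_set_ubound (Sfin (maxn m n)).
exists (fun i => if (i < n)%N then x i else v i), (maxn n p).
split=> [|i ilt|z yz /(_ _ (leq_maxl m n))[i Si]]; first exact: leq_maxl.
  by rewrite ilt.
apply; rewrite yz; last by rewrite (leq_trans (Sp _ Si))// leq_maxr.
by rewrite ltnNge (leq_trans _ (Sge _ _ Si))// leq_maxr.
Qed.

Lemma meager_eventual_mismatch (S : nat -> set nat) (v : cantor_space) :
  (forall n, finite_set (S n)) -> (forall n i, S n i -> (n <= i)%N) ->
  meager [set z : cantor_space | \forall n \near \oo, exists2 i, S n i & z i <> v i].
Proof.
move=> Sfin Sge; pose F m : set cantor_space :=
  [set z | forall n, (m <= n)%N -> exists2 i, S n i & z i <> v i].
apply: (@meagerS _ (\bigcup_m F m)) => [z [m _ zm]|].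
  by exists m => // n; exact: zm.
by apply: meager_bigcup => m; exact/nowhere_dense_meager/nowhere_dense_mismatch.
Qed.

(** * Translations *)

Lemma cantor_addK (x : cantor_space) : cancel (cantor_add^~ x) (cantor_add^~ x).
Proof. by move=> z; apply/funext => i; rewrite /cantor_add -addbA addbb addbF. Qed.

Lemma agree_add n (w x z : cantor_space) :
  agree n x z -> agree n (cantor_add x w) (cantor_add z w).
Proof. by move=> xz i /xz; rewrite /cantor_add => ->. Qed.

Lemma nowhere_dense_translate (w : cantor_space) (F : set cantor_space) :
  nowhere_dense F -> nowhere_dense [set cantor_add z w | z in F].
Proof.
move=> /nowhere_denseP nF; apply/nowhere_denseP => x n.
have [y [m [nm xy yF]]] := nF (cantor_add x w) n.
exists (cantor_add y w), m; split=> [//||z' yz [z Fz zw]].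
  by rewrite -(cantor_addK w x); exact: agree_add.
apply: (yF z) => //; rewrite -(cantor_addK w y) -(cantor_addK w z).
by apply: agree_add; rewrite zw.
Qed.

Lemma meager_translate (w : cantor_space) (A : set cantor_space) :
  meager A -> meager [set cantor_add z w | z in A].
Proof.
move=> [F nF ->]; exists (fun n => [set cantor_add z w | z in F n]).
  by move=> n; exact: nowhere_dense_translate.
by rewrite image_bigcup.
Qed.

Lemma meager_additive1 (x : cantor_space) : meager_additive [set x].
Proof.
move=> A mA; apply: meagerS (meager_translate x mA) => _ [z Az [_ -> <-]].
by exists z.
Qed.

(** * Unary coding: bounding d(R_b) from above *)

Section Unary.
Variables (b : nat -> nat) (b0 : forall n, (0 < b n)%N).

Let a k := (\sum_(i < k) b i)%N.

Let aS k : a k.+1 = (a k + b k)%N.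
Proof. by rewrite /a big_ord_recr. Qed.

Let a_incr k : (a k < a k.+1)%N.
Proof. by rewrite aS -addn1 leq_add2l. Qed.

Let a0 : a 0 = 0.
Proof. by rewrite /a big_ord0. Qed.

Definition unary_code (f : prodb b) : cantor_space :=
  fun i => `[< exists k, i = (\sum_(j < k) b j + f k)%N >].

Let unary_codeE f k i : (a k <= i < a k.+1)%N ->
  unary_code f i = (i == a k + f k)%N.
Proof.
move=> ki; apply/asboolP/eqP => [[l il]|ik]; last by exists k.
suff <- : l = k by [].
apply: (incr_block_inj a_incr _ ki).
by rewrite il -/(a l) leq_addr aS ltn_add2l ltn_ord.
Qed.

Definition hitting_set : set cantor_space :=
  [set z | forall k, exists2 i,
    (\sum_(j < k) b j <= i < \sum_(j < k.+1) b j)%N & z i = true].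

Lemma hitting_set_meager : meager hitting_set.
Proof.
have bfin k : finite_set [set i | (a k <= i < a k.+1)%N].
  apply: (@sub_finite_set _ _ `I_(a k.+1)); last exact: finite_II.
  by move=> i /= /andP[].
apply: meagerS (@meager_eventual_mismatch _ (fun=> false) bfin _).
  by move=> z hz; exists 0 => // k _; have [i ki zi] := hz k; exists i => //; rewrite zi.
by move=> k i /= /andP[ki _]; exact: leq_trans (incr_ge a_incr k) ki.
Qed.

(** The response to B is (J, h), where J and y come from [meager_mismatch] and
[h k] is the number whose unary code y shows on the k-th interval, if any. *)
Lemma meager_bounds_translates (B : set cantor_space) : meager B ->
  exists Ih : interval_partition * prodb b, forall f,
    (forall z, hitting_set z -> B (cantor_add z (unary_code f))) -> Rrel f Ih.
Proof.
move=> /(meager_mismatch a_incr)[c [y [c0 c_incr By]]].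
have [J JE] := incr_partition c_incr c0.
pose good k (j : 'I_(b k)) :=
  forall i, (a k <= i < a k.+1)%N -> y i = (i == a k + j)%N.
pose h k := xget (Ordinal (b0 k)) (good k).
exists (J, h) => f fB.
have hP k : (forall i, (a k <= i < a k.+1)%N -> y i = unary_code f i) -> f k = h k.
  move=> yf; have gf : good k (f k) by move=> i ki; rewrite yf// (unary_codeE _ ki).
  have gh : good k (h k) by apply: xgetPex; exists (f k).
  have kb : (a k <= a k + f k < a k.+1)%N by rewrite leq_addr aS ltn_add2l /=.
  by move: (gh _ kb); rewrite gf// eqxx => /esym; rewrite eqn_add2l => /eqP/val_inj.
(* u follows y on the coarse intervals where h never catches f. *)
pose bad i := exists k n, [/\ (a k <= i < a k.+1)%N, J n k &
  forall l, J n l -> f l <> h l].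
pose u : cantor_space := fun i => if `[< bad i >] then y i else ~~ unary_code f i.
(* On a fine interval inside a bad coarse one, y differs from the unary code,
   for otherwise h would catch f there; elsewhere u is its complement. *)
have Bu : B u.
  rewrite -(cantor_addK (unary_code f) u); apply: fB => k.
  suff [i ki ui] : exists2 i, (a k <= i < a k.+1)%N & u i <> unary_code f i.
    exists i => //; rewrite /cantor_add; move: ui.
    by case: (u i); case: (unary_code f i) => // /(_ erefl).
  have [[n [Jk nfh]]|nobad] := pselect (exists n, J n k /\ forall l, J n l -> f l <> h l).
    apply: contrapT => nomis; apply: (nfh _ Jk); apply: hP => i ki.
    apply: contrapT => yi; apply: nomis; exists i => //.
    by rewrite /u asboolT//; exists k, n.
  exists (a k); first by rewrite leqnn a_incr.
  rewrite /u asboolF; first by case: unary_code.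
  move=> [l [n [al Jl nfh]]]; apply: nobad; exists n; split=> //.
  have <- // : l = k; apply: (incr_block_inj a_incr al).
  by rewrite leqnn a_incr.
have [n0 _ nmatch] := By _ Bu; exists n0 => // n n0n /=.
apply: contrapT => nofh; apply: (nmatch n n0n) => i ni.
rewrite /u asboolT//.
have [k ki] := incr_block_ex a_incr a0 i.
exists k, n; split=> //; last by move=> l Jl fl; apply: nofh; exists l.
rewrite JE /=; case/andP: ki => ki ik; case/andP: ni => ni im; apply/andP; split.
  rewrite leqNgt; apply/negP => /(incr_leq a_incr) /(leq_trans ik).
  by rewrite leqNgt ltnS ni.
rewrite ltnNge; apply/negP => /(incr_leq a_incr) kc.
by have := leq_trans im (leq_trans kc ki); rewrite ltnn.
Qed.

(** The common core of the bounds by cov(MA) and by cof(M): K only has to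
contain, up to inclusion, the translates of one fixed meager set. *)
Lemma frakd_le_translates (K : set (set cantor_space)) : K `<=` @meager cantor_space ->
  (forall f, exists2 B, K B &
     forall z, hitting_set z -> B (cantor_add z (unary_code f))) ->
  frakd (Rsys b b0) #<= K.
Proof.
move=> Kmeager Kf.
have /choice[phi phiP] : forall B, exists Ih : interval_partition * prodb b,
    meager B -> forall f,
    (forall z, hitting_set z -> B (cantor_add z (unary_code f))) -> Rrel f Ih.
  move=> B; have [/meager_bounds_translates[Ih IhP]|nB] := pselect (meager B).
    by exists Ih.
  by exists (unsquash (rcod_ne (Rsys b b0))).
apply: min_card_le; exists (phi @` K); last exact: card_image_le.
move=> f; have [B KB Bf] := Kf f; exists (phi B); first by exists B.
exact: phiP (Kmeager _ KB) _ Bf.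
Qed.

End Unary.

Lemma frakd_le_cofM b b0 : frakd (Rsys b b0) #<= cofI (@meager cantor_space).
Proof.
have [|[cof_meager cof] _] := @min_cardP _ [set J | J `<=` @meager cantor_space /\
    forall A, meager A -> exists2 B, J B & A `<=` B].
  by exists (@meager cantor_space); split=> // A mA; exists A.
apply: frakd_le_translates cof_meager _ => f.
have [B JB sB] := cof _ (meager_translate (unary_code f) (hitting_set_meager b0)).
by exists B => // z hz; apply: sB; exists z.
Qed.

Lemma covMA_spec : covI meager_additive `<=` meager_additive /\
  \bigcup_(A in covI meager_additive) A = [set: cantor_space].
Proof.
have [|//] := @min_cardP _ [set J | J `<=` meager_additive /\
    \bigcup_(A in J) A = [set: cantor_space]].
exists meager_additive; split=> //; apply/seteqP; split=> // x _.
by exists [set x] => //; exact: meager_additive1.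
Qed.

Lemma frakd_le_covMA b b0 : frakd (Rsys b b0) #<= covI meager_additive.
Proof.
have [covMA covT] := covMA_spec.
pose sum X := [set cantor_add a x | a in hitting_set b & x in X].
apply: card_le_trans (card_image_le sum _).
apply: frakd_le_translates => [_ [X JX <-]|f].
  exact: covMA JX _ (hitting_set_meager b0).
have [X JX Xf] : (\bigcup_(A in covI meager_additive) A) (unary_code f).
  by rewrite covT.
by exists (sum X) => [|z hz]; [exists X | exists z => //; exists (unary_code f)].
Qed.

(** * Prefix coding: bounding cov(MA) from above *)

Section Prefix.
Variables (b : nat -> nat) (b0 : forall n, (0 < b n)%N).

Let card_prefix_le k : (#|{: (trunc_log 2 (b k)).-tuple bool}| <= b k)%N.
Proof. by rewrite card_tuple card_bool trunc_logP. Qed.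

Definition prefix_code (x : cantor_space) : prodb b := fun k =>
  widen_ord (card_prefix_le k) (enum_rank [tuple x i | i < trunc_log 2 (b k)]).

Lemma prefix_codeP x y k :
  prefix_code x k = prefix_code y k <-> agree (trunc_log 2 (b k)) x y.
Proof.
split=> [/(congr1 val)/= /val_inj/enum_rank_inj xy i ik|xy].
  by have := congr1 (fun t => tnth t (Ordinal ik)) xy; rewrite !tnth_mktuple.
rewrite /prefix_code; congr (widen_ord _ (enum_rank _)).
by apply: eq_from_tnth => i; rewrite !tnth_mktuple xy.
Qed.

(** A number [h k] that is not a code of any initial segment is never met, so
the default value taken by y there is harmless. *)
Lemma prefix_code_guess (h : prodb b) : exists y : nat -> cantor_space,
  forall x k, prefix_code x k = h k -> agree (trunc_log 2 (b k)) (y k) x.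
Proof.
exists (fun k => xget point [set x | prefix_code x k = h k]) => x k xh.
apply/prefix_codeP; rewrite xh.
by apply: (@xgetPex _ point [set x | prefix_code x k = h k]); exists x.
Qed.

End Prefix.

(** Let A mismatch y on almost all intervals.  When x agrees with v on an interval
where z in A differs from y, the sum z + x differs from y + v there; this
happens in almost every block of J, so A + X mismatches y + v on almost all the
coarser blocks. *)
Lemma meager_additive_of_block_guess (X : set cantor_space) :
  (forall a : nat -> nat, (forall k, (a k < a k.+1)%N) ->
     exists (J : interval_partition) (v : cantor_space), forall x, X x ->
       \forall n \near \oo, exists2 k, J n k &
         forall i, (a k <= i < a k.+1)%N -> x i = v i) ->
  meager_additive X.
Proof.
move=> Xguess A mA.
have [a [y [_ a_incr Ay]]] := @meager_mismatch id A (fun=> leqnn _) mA.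
have [J [v Xv]] := Xguess a a_incr.
pose S n := [set i | exists2 k, J n k & (a k <= i < a k.+1)%N].
apply: (meagerS _ (@meager_eventual_mismatch S (cantor_add y v) _ _)).
- move=> _ [z Az [x Xx <-]]; have [n1 _ zy] := Ay _ Az; have [n2 _ xv] := Xv _ Xx.
  exists (maxn n1 n2) => // n /=; rewrite geq_max => /andP[n1n n2n].
  have [k Jk xvk] := xv n n2n.
  have {}zy := zy k (leq_trans n1n (block_ge Jk)).
  apply: contrapT => nomis; apply: zy => i ki.
  apply: contrapT => ziyi; apply: nomis; exists i; first by exists k.
  by rewrite /cantor_add xvk// => /addIb.
- move=> n; have [p Jp] := finite_set_ubound (block_finite J n).
  apply: (@sub_finite_set _ _ `I_(a p)); last exact: finite_II.
  move=> i [k Jk /andP[_ ik]] /=; apply: leq_trans ik _.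
  by apply: (incr_leq a_incr); exact: Jp.
- move=> n i [k /block_ge nk /andP[ki _]].
  exact: leq_trans nk (leq_trans (incr_ge a_incr k) ki).
Qed.

(** Some b in the family dominates 2 ^ a (k + 1), and then the initial segment
coded by [prefix_code x k] contains the k-th interval. *)
Lemma meager_additive_of_dominating (D : set (nat -> nat))
    (D0 : forall b, D b -> forall n, (0 < b n)%N) (X : set cantor_space) :
  dominating D ->
  (forall b (Db : D b), exists Ih : interval_partition * prodb b,
     forall x, X x -> Rrel (prefix_code (D0 b Db) x) Ih) ->
  meager_additive X.
Proof.
move=> Ddom XD; apply: meager_additive_of_block_guess => a a_incr.
have [b Db [n0 _ ab]] := Ddom (fun k => 2 ^ a k.+1)%N.
have [[J h] Xh] := XD b Db.
have [y yh] := prefix_code_guess (D0 b Db) h.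
have [v vy] := incr_glue a_incr y.
exists J, v => x /Xh[n1 _ xh]; exists (maxn n0 n1) => // n /=.
rewrite geq_max => /andP[n0n /xh[k Jk xhk]]; exists k => // i ki.
rewrite (vy k)//; apply: (yh x k xhk); have /andP[_ ik] := ki.
apply: leq_trans ik _; apply: trunc_log_max => //; apply: ab.
exact: leq_trans n0n (block_ge Jk).
Qed.

Lemma Rrel_refl b (I : interval_partition) (f : prodb b) : Rrel f (I, f).
Proof. by exists 0 => // n _; have [k Ik] := block_nonempty I n; exists k. Qed.

Lemma frakdP (S : relsys) : (forall x : rdom S, exists y, rrel x y) ->
  forall x : rdom S, exists2 y, frakd S y & rrel x y.
Proof.
move=> Sbnd; have [|//] := @min_cardP _ [set E : set (rcod S) |
    forall x, exists2 y, E y & rrel x y].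
by exists setT => x; have [y xy] := Sbnd x; exists y.
Qed.

Lemma covMA_le_frakd_prod (D : set (nat -> nat))
    (D0 : forall b, D b -> forall n, (0 < b n)%N) : dominating D ->
  covI meager_additive
    #<= frakd (prod_relsys (fun b : D => Rsys (val b) (D0 (val b) (set_valP b)))).
Proof.
move=> Ddom; set S := prod_relsys _.
have Sbnd (x : rdom S) : exists y, rrel x y.
  by exists (fun b => (unsquash interval_partition_ne, x b)) => b; exact: Rrel_refl.
pose code (x : cantor_space) : rdom S := fun b => prefix_code (D0 (val b) (set_valP b)) x.
pose bounded (e : rcod S) := [set x | rrel (code x) e].
apply: min_card_le; exists (bounded @` frakd S); last exact: card_image_le.
split=> [_ [e _ <-]|].
  apply: (@meager_additive_of_dominating D D0) => // b Db.
  have bD : b \in D by apply/mem_set.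
  exists (e (exist _ b bD)) => x /(_ (exist _ b bD)).
  by rewrite (Prop_irrelevance (D0 b Db) (D0 _ (set_valP (exist _ b bD)))).
apply/seteqP; split=> // x _; have [e Ee xe] := frakdP Sbnd (code x).
by exists (bounded e) => //; exists e.
Qed.

(** * Closed null sets: cov(E) and non(E) *)

Section Measure.
Variable R : realType.

(** The measure of [cylinder s] relative to [cylinder t], that is, the measure of
their intersection divided by that of [cylinder t]. *)
Fixpoint rel_measure (t s : seq bool) : R :=
  match t, s with
  | [::], _ => ((2 ^+ size s)^-1)%R
  | _ :: _, [::] => 1%R
  | x :: t', y :: s' => if x == y then rel_measure t' s' else 0%R
  end.

Lemma rel_measure_ge0 t s : (0 <= rel_measure t s)%R.
Proof.
elim: t s => [|x t IH] [|y s] //=; rewrite ?invr_ge0 ?exprn_ge0//.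
by case: ifP.
Qed.

Lemma rel_measure_split t s :
  (rel_measure (rcons t true) s + rel_measure (rcons t false) s =
   rel_measure t s + rel_measure t s)%R.
Proof.
elim: t s => [|x t IH] [|y s] //=; first by rewrite expr0 invr1.
  have half2 : ((2 ^+ size s)^-1 = (2 ^+ (size s).+1)^-1 + (2 ^+ (size s).+1)^-1 :> R)%R.
    by rewrite exprSr invfM -mulrDr -mulr2n -[X in (_ * X)%R]mulr_natr mulVf ?pnatr_eq0// mulr1.
  by case: y; rewrite /= ?addr0 ?add0r.
by case: ifP => // _; rewrite ?addr0.
Qed.

Lemma rel_measure_le t s : (rel_measure t s <= 2 ^+ size t * (2 ^+ size s)^-1)%R.
Proof.
elim: t s => [|x t IH] [|y s] /=; rewrite ?expr0 ?mul1r//.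
  by rewrite invr1 mulr1 exprn_ege1// ler1n.
case: ifP => _; last by rewrite mulr_ge0 ?invr_ge0 ?exprn_ge0.
by rewrite !exprS invfM mulrACA divff ?mul1r// pnatr_eq0.
Qed.

Lemma rel_measure1 t s : (size s <= size t)%N ->
  (forall i, (i < size s)%N -> nth false t i = nth false s i) ->
  rel_measure t s = 1%R.
Proof.
elim: t s => [|x t IH] [|y s] //=; first by rewrite expr0 invr1.
move=> st ts; have /= -> := ts 0 isT; rewrite eqxx IH// => i ilt.
exact: (ts i.+1).
Qed.

(** The relative measure is the mean of those in the two halves of [cylinder t],
so a cover that is too small for [cylinder t] is too small for one half. *)
Lemma cylinder_extend (s : nat -> seq bool) (t : seq bool) :
  (\sum_(0 <= i <oo) (rel_measure t (s i))%:E < 1)%E ->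
  exists c, (\sum_(0 <= i <oo) (rel_measure (rcons t c) (s i))%:E < 1)%E.
Proof.
move=> t1; apply: contrapT => /forallNP noc.
have ge1 c : (1 <= \sum_(0 <= i <oo) (rel_measure (rcons t c) (s i))%:E)%E.
  by rewrite leNgt; apply/negP.
have := leeD (ge1 true) (ge1 false).
have ge0 u i : (0 <= (rel_measure u (s i))%:E)%E by rewrite lee_fin rel_measure_ge0.
rewrite -nneseriesD//; under eq_eseriesr do rewrite -EFinD rel_measure_split EFinD.
rewrite nneseriesD// leNgt => /negP; apply.
by apply: lteD.
Qed.

(** If the cylinders [s i] were too small, halving repeatedly would give a
branch z along which their total relative measure stays below 1; but once the
cylinder [s i] containing z is reached, its relative measure alone is 1. *)
Lemma agree_cover_measure n (x : cantor_space) (s : nat -> seq bool) :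
  agree n x `<=` \bigcup_i cylinder (s i) ->
  (((2 ^+ n)^-1 : R)%:E <= \sum_(0 <= i <oo) ((2 ^+ size (s i))^-1 : R)%:E)%E.
Proof.
move=> cover; rewrite leNgt; apply/negP => small.
have ge0 u i : (0 <= (rel_measure u (s i))%:E)%E by rewrite lee_fin rel_measure_ge0.
have /choice[ext extP] : forall t, exists c,
    (\sum_(0 <= i <oo) (rel_measure t (s i))%:E < 1)%E ->
    (\sum_(0 <= i <oo) (rel_measure (rcons t c) (s i))%:E < 1)%E.
  move=> t; have [/cylinder_extend[c ct]|nt] :=
    pselect (\sum_(0 <= i <oo) (rel_measure t (s i))%:E < 1)%E; first by exists c.
  by exists true.
pose T j := iter j (fun t => rcons t (ext t)) (mkseq x n).
have sizeT j : size (T j) = (n + j)%N.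
  by elim: j => [|j IH]; rewrite /= ?size_mkseq ?addn0// size_rcons IH addnS.
have T1 j : (\sum_(0 <= i <oo) (rel_measure (T j) (s i))%:E < 1)%E.
  elim: j => [|j]; last exact: extP.
  apply: (@le_lt_trans _ _ (\sum_(0 <= i <oo) ((2 ^+ n)%:E * ((2 ^+ size (s i))^-1 : R)%:E))%E).
    apply: lee_nneseries => // i _; rewrite -EFinM lee_fin.
    by have := rel_measure_le (mkseq x n) (s i); rewrite size_mkseq.
  rewrite nneseriesZl => [|i _]; last by rewrite lee_fin invr_ge0 exprn_ge0.
  have n0 : (0 < 2 ^+ n :> R)%R by rewrite exprn_gt0.
  move: small; rewrite -(@lte_pmul2l _ (2 ^+ n)%:E)// => /lt_le_trans; apply.
  by rewrite -EFinM divff// gt_eqF.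
have Tstable j k i : (j <= k)%N -> (i < n + j)%N -> nth false (T k) i = nth false (T j) i.
  move=> /subnK <- ij; elim: (k - j)%N => // m IH.
  by rewrite addSn /= nth_rcons sizeT (leq_trans ij)// leq_add2l leq_addl.
pose z : cantor_space := fun i => nth false (T i.+1) i.
have zT j i : (i < n + j)%N -> z i = nth false (T j) i.
  move=> ij; have ii : (i < n + i.+1)%N by rewrite addnS ltnS leq_addl.
  by have [ji|/ltnW ji] := leqP j i.+1; [apply: Tstable|apply/esym/Tstable].
have [i ilt|i _ zi] := cover z.
  by rewrite (zT 0) ?addn0// /T /= nth_mkseq.
have := T1 (size (s i)); rewrite ltNge => /negP; apply.
rewrite (nneseriesD1 (n := i))// rel_measure1; first by rewrite leeDl// nneseries_ge0.
  by rewrite sizeT leq_addl.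
by move=> l ls; rewrite -zT ?zi// (leq_trans ls)// leq_addl.
Qed.

Lemma closed_null_nowhere_dense (F : set cantor_space) :
  closed F -> cantor_outer_measure R F = 0%E -> nowhere_dense F.
Proof.
move=> /closure_id cF F0; rewrite /nowhere_dense -cF -subset0 => x /nbhs_agree[n xF].
have : (((2 ^+ n)^-1 : R)%:E <= cantor_outer_measure R F)%E.
  apply: le_ereal_inf_tmp => _ [s Fs <-].
  exact: agree_cover_measure (subset_trans xF Fs).
by rewrite F0 lee_fin leNgt invr_gt0 exprn_gt0.
Qed.

Lemma ideal_E_meager : ideal_E R `<=` @meager cantor_space.
Proof.
apply: smallest_sub; first exact: meager_sigma_ideal.
by move=> F [cF F0]; exact/nowhere_dense_meager/closed_null_nowhere_dense.
Qed.

Lemma ideal_ES (A B : set cantor_space) :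
  A `<=` B -> ideal_E R B -> ideal_E R A.
Proof. by move=> AB EB M EM; case: (EM) => -[_ Msub _] _; exact: Msub AB (EB M EM). Qed.

Section SmallSum.
Variables (b : nat -> nat) (b0 : forall n, (0 < b n)%N).
Hypothesis bsum : (\sum_(0 <= k <oo) (((b k)%:R)^-1 : R)%:E < +oo)%E.

Lemma closed_prefix_code (J : interval_partition) (h : prodb b) m :
  closed [set x | forall n, (m <= n)%N -> exists2 k, J n k & prefix_code b0 x k = h k].
Proof.
rewrite -openC openE => x /existsNP[n /not_implyP[mn nox]].
have [p Jp] := finite_set_ubound (finite_image (fun k => trunc_log 2 (b k)) (block_finite J n)).
apply/nbhs_agree; exists p => z xz /(_ n mn)[k Jk zk]; apply: nox; exists k => //.
rewrite -zk; apply/prefix_codeP; apply: agree_widen xz.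
by apply: ltnW; apply: Jp; exists k.
Qed.

(** Every x in the set satisfies [prefix_code x k = h k] for arbitrarily large k,
so it lies in one of the corresponding cylinders with k >= K; their measures
are at most 2 / b k and sum up to a tail of a convergent series. *)
Lemma null_prefix_code (J : interval_partition) (h : prodb b) m :
  cantor_outer_measure R
    [set x | forall n, (m <= n)%N -> exists2 k, J n k & prefix_code b0 x k = h k] = 0%E.
Proof.
set F := [set x | _]; apply/eqP; rewrite eq_le; apply/andP; split; last first.
  apply: le_ereal_inf_tmp => _ [s _ <-]; apply: nneseries_ge0 => i _ _.
  by rewrite lee_fin invr_ge0 exprn_ge0.
have ge0 k : (0 <= ((b k)%:R^-1 : R)%:E)%E by rewrite lee_fin invr_ge0.
have tail0 := nneseries_tail_cvg bsum (fun k _ => ge0 k).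
have := cvgeZl (y := 2%:E) isT tail0; rewrite mule0.
apply: cvge_ge; exists 0 => // K _.
have [y yh] := prefix_code_guess b0 h.
pose s i := mkseq (y (i + K)) (trunc_log 2 (b (i + K))).
apply: (@le_trans _ _ (\sum_(0 <= i <oo) ((2 ^+ size (s i))^-1 : R)%:E)%E).
  apply: ereal_inf_lbound; exists s => // x /(_ (maxn m K))[|k Jk xk].
    exact: leq_maxl.
  have Kk : (K <= k)%N by apply: leq_trans (block_ge Jk); exact: leq_maxr.
  exists (k - K) => // i; rewrite size_mkseq subnK// => ik.
  by rewrite nth_mkseq subnK//; exact: (yh x k).
rewrite -(nneseries_addn K)// -nneseriesZl//.
apply: lee_nneseries => i _; first by rewrite lee_fin invr_ge0 exprn_ge0.
rewrite size_mkseq -EFinM lee_fin.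
set c := b (i + K); have c0 : (0 < c)%N by exact: b0.
rewrite -ler_pdivrMl// -invfM -exprS lef_pV2 ?posrE ?exprn_gt0 ?ltr0n//.
by rewrite -natrX ler_nat ltnW// trunc_log_ltn.
Qed.

Lemma prefix_code_bounded_E (Ih : interval_partition * prodb b) :
  ideal_E R [set x | Rrel (prefix_code b0 x) Ih].
Proof.
case: Ih => J h M [[_ Msub Mcup] GM].
apply: Msub (Mcup (fun m => [set x | forall n, (m <= n)%N ->
  exists2 k, J n k & prefix_code b0 x k = h k]) _).
  by move=> x [m _ xm]; exists m => // n; exact: xm.
by move=> m; apply: GM; split; [exact: closed_prefix_code|exact: null_prefix_code].
Qed.

Lemma frakb_le_nonE : frakb (Rsys b b0) #<= nonI (ideal_E R).
Proof.
have [|nonE _] := @min_cardP _ [set A | ~ ideal_E R A].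
  by exists setT => /ideal_E_meager; exact: not_meagerT.
apply: min_card_le; exists (prefix_code b0 @` nonI (ideal_E R)); last exact: card_image_le.
move=> [Ih bnd]; apply: nonE; apply: ideal_ES (prefix_code_bounded_E Ih) => x Ax.
by apply: bnd; exists x.
Qed.

Lemma covE_le_frakd : covI (ideal_E R) #<= frakd (Rsys b b0).
Proof.
pose S := Rsys b b0.
have Sbnd (x : rdom S) : exists y, rrel x y.
  by exists (unsquash interval_partition_ne, x); exact: Rrel_refl.
pose bounded Ih := [set x | Rrel (prefix_code b0 x) Ih].
apply: min_card_le; exists (bounded @` frakd S); last exact: card_image_le.
split=> [_ [Ih _ <-]|]; first exact: prefix_code_bounded_E.
apply/seteqP; split=> // x _; have [Ih dIh xIh] := frakdP Sbnd (prefix_code b0 x).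
by exists (bounded Ih) => //; exists Ih.
Qed.

End SmallSum.
End Measure.

(** * The theorem *)

Theorem theoremB (R : realType) :
  [/\ (forall (D : set (nat -> nat))
              (D0 : forall b, D b -> forall n, (0 < b n)%N),
         dominating D ->
         sup_card (fun b : D => frakd (Rsys (val b) (D0 (val b) (set_valP b))))
           #<= covI meager_additive /\
         covI meager_additive
           #<= frakd (prod_relsys (fun b : D => Rsys (val b) (D0 (val b) (set_valP b))))),
      (forall (b : nat -> nat) (b0 : forall n, (0 < b n)%N),
         frakd (Rsys b b0) #<= cofI (@meager cantor_space)) &
      (forall (b : nat -> nat) (b0 : forall n, (0 < b n)%N),
         (\sum_(0 <= k <oo) (((b k)%:R)^-1 : R)%:E < +oo)%E ->
         frakb (Rsys b b0) #<= nonI (ideal_E R) /\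
         covI (ideal_E R) #<= frakd (Rsys b b0))].
Proof.
split=> [D D0 Ddom|b b0|b b0 bsum].
- split; last exact: covMA_le_frakd_prod.
  by apply: sup_card_le => b; exact: frakd_le_covMA.
- exact: frakd_le_cofM.
- by split; [exact: frakb_le_nonE|exact: covE_le_frakd].
Qed.
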